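(* There is a universal constant $C_0>0$ such that the following holds. Let $\mu>0$, $M\ge1$, let $X$ be a separable Hilbert space and let $A:\mathcal{D}(A)\subseteq X\to X$ be a densely defined closed linear operator. Assume that $A$ generates a bounded semigroup $e^{At}$, $t\ge0$, with $$\|e^{At}\|_{X\to X}\le M\quad\text{for all }t\ge0.$$ Assume that for every $\lambda\in\mathbb{R}$ the operator $i\lambda-A:\mathcal{D}(A)\to X$ is invertible with $$\|(i\lambda-A)^{-1}\|_{X\to X}\le\mu^{-1}.$$ Then for all $t\ge0$, $$\|e^{At}\|_{X\to X}\le C_0M^2e^{-\mu t}.$$
   Context: ''Semigroup generated by $A$'' means strongly continuous ($C_0$) semigroup; $\|\cdot\|_{X\to X}$ is the operator norm. *)

(* Defs.v *)
From Stdlib Require Import Reals.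
From Coquelicot Require Import Coquelicot.

Set Implicit Arguments.
Unset Strict Implicit.
Unset Printing Implicit Defensive.

Open Scope R_scope.

(* Complex Hilbert space; the inner product is linear in its first argument
   and its real-valued norm and completeness are those of Coquelicot. *)
Record HilbertSpace := {
  hcarrier :> CompleteNormedModule C_AbsRing;
  inner : hcarrier -> hcarrier -> C;
  inner_plus_l : forall x y z : hcarrier,
    inner (plus x y) z = Cplus (inner x z) (inner y z);
  inner_scal_l : forall (a : C) (x y : hcarrier),
    inner (scal a x) y = Cmult a (inner x y);
  inner_conj : forall x y : hcarrier, inner y x = Cconj (inner x y);
  inner_norm : forall x : hcarrier, inner x x = RtoC (norm x ^ 2)
}.

Definition dense (X : UniformSpace) (E : X -> Prop) : Prop :=
  forall (x : X) (eps : posreal), exists y : X, E y /\ ball x eps y.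

Definition separable (X : UniformSpace) : Prop :=
  exists u : nat -> X, dense (fun x => exists n : nat, x = u n).

(* The supremum is taken in the extended reals: it is [p_infty] for an
   unbounded map, and 0 for a linear map on the zero space. *)
Definition op_norm (X : NormedModule C_AbsRing) (T : X -> X) : Rbar :=
  Lub_Rbar (fun r : R => exists x : X, norm x <= 1 /\ r = norm (T x)).

(* A linear operator D(A) -> X; the values of [op] outside [dom] are
   irrelevant. *)
Record LinOp (X : NormedModule C_AbsRing) := {
  dom : X -> Prop;
  op : X -> X;
  dom_zero : dom zero;
  dom_plus : forall x y : X, dom x -> dom y -> dom (plus x y);
  dom_scal : forall (a : C) (x : X), dom x -> dom (scal a x);
  op_plus : forall x y : X, dom x -> dom y ->
    op (plus x y) = plus (op x) (op y);
  op_scal : forall (a : C) (x : X), dom x -> op (scal a x) = scal a (op x)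
}.

Definition graph (X : NormedModule C_AbsRing) (A : LinOp X) (p : X * X) : Prop :=
  dom A (fst p) /\ op A (fst p) = snd p.

Definition densely_defined (X : NormedModule C_AbsRing) (A : LinOp X) : Prop :=
  dense (dom A).

Definition closed_op (X : NormedModule C_AbsRing) (A : LinOp X) : Prop :=
  closed (T := prod_UniformSpace X X) (graph A).

(* Only the values [T t] with [0 <= t] are constrained. *)
Record C0_semigroup (X : NormedModule C_AbsRing) (T : R -> X -> X) : Prop := {
  sg_linear : forall t : R, 0 <= t -> is_linear (T t);
  sg_zero : forall x : X, T 0 x = x;
  sg_add : forall (s t : R) (x : X), 0 <= s -> 0 <= t -> T (s + t) x = T s (T t x);
  sg_cont : forall x : X, filterlim (fun t : R => T t x) (at_right 0) (locally x)
}.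

(* The equivalence includes the domain: D(A) is exactly the set of [x] at
   which the difference quotient converges. *)
Definition generates (X : NormedModule C_AbsRing) (A : LinOp X) (T : R -> X -> X)
  : Prop :=
  C0_semigroup T /\
  forall x y : X,
    graph A (x, y) <->
    filterlim (fun h : R => scal (RtoC (/ h)) (minus (T h x) x))
      (at_right 0) (locally y).

(* [S] is the two-sided inverse X -> D(A) of [z - A : D(A) -> X]. *)
Definition is_resolvent (X : NormedModule C_AbsRing) (A : LinOp X) (z : C)
    (S : X -> X) : Prop :=
  (forall y : X, dom A (S y) /\ minus (scal z (S y)) (op A (S y)) = y) /\
  (forall x : X, dom A x -> S (minus (scal z x) (op A x)) = x).

(* Main.v *)
Require Import Defs.
From Stdlib Require Import Reals Lra Lia.
From Coquelicot Require Import Coquelicot.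
Open Scope R_scope.

(** Let [x] be in the domain and [u(s) = chi(s) T(s) x] with [chi] vanishing at
    both ends of an interval. Then [u' - A u = chi' T x], and taking the Fourier
    transform turns the resolvent bound on the imaginary axis into the energy
    inequality
      [mu^2 * int chi^2 |T x|^2 <= int chi'^2 |T x|^2].
    A segment on which [|chi'| = mu chi], that is, on which [chi] grows or decays
    like [exp(mu s)] or [exp(- mu s)], contributes nothing to the difference
    of the two sides. So take [chi] rising linearly to 1 on a segment of length
    [1/mu], growing exponentially to about [exp(mu t)], constant on a segment of
    length [1/mu] that ends just before [t], and then symmetric. The two linear
    segments cost at most [2 mu M^2 |x|^2]. On the plateau
    [|T(s) x| >= |T(t) x| / M], so the plateau gains a multiple of
    [mu exp(2 mu t) |T(t) x|^2 / M^2]. Comparing both gives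
    [|T(t) x| <= C0 M^2 exp(- mu t) |x|], first on the domain and then
    everywhere by density.

    The energy inequality has an exact discrete form, so finite sums take the
    place of the integrals. For a periodic sequence [u] in the domain, write
    [w_j = (u_j + u_{j+1})/2]. The discrete Fourier transform diagonalizes both
    the difference quotient and the average, and the quotient of their symbols is
    [(2 i/h) tan(theta/2)], which lies on the imaginary axis. Hence
    [sum |w_j|^2 <= mu^-2 sum |(u_{j+1} - u_j)/h - A w_j|^2] for every step [h]
    ([midpoint_le_defect]). On the sequence [chi_j T(j h) x] the midpoint scheme
    is consistent as [h] tends to 0 ([trajectory_defect]), which gives
    [weighted_trajectory_estimate]; the discrete weight is [bump], whose gains
    and costs are counted in [bump_cost]; [decay_on_domain] compares them. *)

(** * Complex Hilbert spaces *)

Lemma inner_plus_r (X : HilbertSpace) (x y z : X) :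
  inner x (plus y z) = Cplus (inner x y) (inner x z).
Proof.
  rewrite (inner_conj (plus y z) x), inner_plus_l, Cplus_conj.
  now rewrite <- !inner_conj.
Qed.

Lemma inner_scal_r (X : HilbertSpace) (a : C) (x y : X) :
  inner x (scal a y) = Cmult (Cconj a) (inner x y).
Proof.
  now rewrite (inner_conj (scal a y) x), inner_scal_l, Cmult_conj, <- inner_conj.
Qed.

Lemma inner_opp_l (X : HilbertSpace) (x y : X) :
  inner (opp x) y = Copp (inner x y).
Proof.
  replace (opp x) with (scal (opp one : C_AbsRing) x) 
    by exact (@scal_opp_one _ (CompleteNormedModule.ModuleSpace _ X) x).
  rewrite inner_scal_l.
  change (Cmult (Copp (RtoC 1)) (inner x y) = Copp (inner x y)); ring.
Qed.

Lemma inner_zero_l (X : HilbertSpace) (y : X) : inner zero y = RtoC 0.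
Proof.
  replace (zero : X) with (scal (zero : C_AbsRing) y) 
    by exact (@scal_zero_l _ (CompleteNormedModule.ModuleSpace _ X) y).
  rewrite inner_scal_l.
  change (Cmult (RtoC 0) (inner y y) = RtoC 0); ring.
Qed.

(* Terms coming from the algebraic hierarchy have an unfolded carrier, on which
   [ring] does not find its structure unless the type is restated as [C]. *)
Ltac C_ring :=
  match goal with |- @eq _ ?a ?b => change (@eq C a b) end; ring.

Lemma minus_zero_eq (G : AbelianGroup) (x y : G) : minus x y = zero -> x = y.
Proof.
  intro H. transitivity (plus (minus x y) y).
  - unfold minus; now rewrite <- plus_assoc, plus_opp_l, plus_zero_r.
  - now rewrite H, plus_zero_l.
Qed.

(** Pairing with an arbitrary vector reduces identities between vectors to
    identities in [C], which ring tactics decide; [hilbert_eq] relies on it. *)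
Lemma inner_ext (X : HilbertSpace) (x y : X) :
  (forall z : X, inner x z = inner y z) -> x = y.
Proof.
  intro H.
  assert (Hn : norm (minus x y) = 0).
  { assert (E : inner (minus x y) (minus x y) = RtoC 0).
    { unfold minus at 1; rewrite inner_plus_l, inner_opp_l, H; ring. }
    rewrite inner_norm in E; apply RtoC_inj in E.
    apply Rsqr_0_uniq; unfold Rsqr; simpl in E; lra. }
  exact (minus_zero_eq _ x y (norm_eq_zero _ Hn)).
Qed.

Ltac inner_simpl :=
  unfold minus;
  repeat (rewrite ?inner_plus_l, ?inner_scal_l, ?inner_opp_l, ?inner_zero_l).

Ltac hilbert_eq :=
  apply inner_ext; let z := fresh "z" in intro z; inner_simpl; C_ring.

(** * Discrete Fourier transform *)

Lemma sum_n_RtoC (f : nat -> R) (n : nat) :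
  RtoC (sum_n f n) = sum_n (fun j => RtoC (f j)) n.
Proof.
  induction n as [|n IH]; [now rewrite !sum_O|].
  rewrite !sum_Sn, <- IH; exact (RtoC_plus _ _).
Qed.

Lemma inner_sum_l (X : HilbertSpace) (f : nat -> X) (y : X) (n : nat) :
  inner (sum_n f n) y = sum_n (fun j => inner (f j) y) n.
Proof.
  induction n as [|n IH]; [now rewrite !sum_O|].
  rewrite !sum_Sn, <- IH; exact (inner_plus_l _ _ _).
Qed.

Lemma inner_sum_r (X : HilbertSpace) (f : nat -> X) (y : X) (n : nat) :
  inner y (sum_n f n) = sum_n (fun j => inner y (f j)) n.
Proof.
  induction n as [|n IH]; [now rewrite !sum_O|].
  rewrite !sum_Sn, <- IH; exact (inner_plus_r _ _ _ _).
Qed.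

Lemma sum_n_delta (G : AbelianMonoid) (j n : nat) (a : nat -> G) :
  (j <= n)%nat -> sum_n (fun l => if Nat.eqb j l then a l else zero) n = a j.
Proof.
  assert (Hz : forall m, (m < j)%nat ->
    sum_n (fun l => if Nat.eqb j l then a l else zero) m = zero).
  { intros m Hm. rewrite (sum_n_ext_loc _ (fun _ => zero)).
    - apply sum_n_m_const_zero.
    - intros k Hk; destruct (Nat.eqb_spec j k); [lia|easy]. }
  induction n as [|n IH]; intro Hj.
  - rewrite sum_O. replace j with 0%nat by lia. reflexivity.
  - rewrite sum_Sn. destruct (Nat.eqb_spec j (S n)) as [->|Hne].
    + rewrite Hz by lia. apply plus_zero_l.
    + rewrite IH by lia. apply plus_zero_r.
Qed.

Definition cis (t : R) : C := (cos t, sin t).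

Lemma cis_0 : cis 0 = RtoC 1.
Proof. unfold cis; now rewrite cos_0, sin_0. Qed.

Lemma cis_plus (s t : R) : cis (s + t) = Cmult (cis s) (cis t).
Proof.
  unfold cis, Cmult; simpl; rewrite cos_plus, sin_plus.
  f_equal; ring.
Qed.

Lemma cis_opp (t : R) : cis (- t) = Cconj (cis t).
Proof. unfold cis, Cconj; simpl; now rewrite cos_neg, sin_neg. Qed.

Lemma cis_2PI_mult (j : nat) : cis (2 * PI * INR j) = RtoC 1.
Proof.
  replace (2 * PI * INR j) with (0 + 2 * INR j * PI) by ring.
  unfold cis; now rewrite cos_period, sin_period, cos_0, sin_0.
Qed.

Lemma cis_neq_1 (t : R) : 0 < Rabs t < 2 * PI -> cis t <> RtoC 1.
Proof.
  intros Ht E. apply (f_equal fst) in E; simpl in E.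
  replace t with (2 * (t / 2)) in E by field.
  rewrite cos_2a_sin in E.
  assert (Hs : sin (t / 2) = 0) by nra.
  unfold Rabs in Ht; destruct (Rcase_abs t) in Ht.
  - assert (0 < sin (- (t / 2))) by (apply sin_gt_0; lra).
    rewrite sin_neg in H; lra.
  - assert (0 < sin (t / 2)) by (apply sin_gt_0; lra). lra.
Qed.

(** The angle of the [k]-th among the [n+1] roots of unity: as for [sum_n], the
    sequences considered have the [n+1] entries [0..n]. *)
Definition freq (n k : nat) : R := 2 * PI * INR k / INR (S n).

Lemma cis_geometric (t : R) (n : nat) :
  Cmult (Cminus (cis t) (RtoC 1)) (sum_n (fun k => cis (INR k * t)) n)
  = Cminus (cis (INR (S n) * t)) (RtoC 1).
Proof.
  induction n as [|n IH].
  - rewrite sum_O; simpl. rewrite Rmult_0_l, Rmult_1_l, cis_0; ring.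
  - rewrite sum_Sn.
    change (plus (sum_n (fun k => cis (INR k * t)) n) (cis (INR (S n) * t)))
      with (Cplus (sum_n (fun k => cis (INR k * t)) n) (cis (INR (S n) * t))).
    rewrite Cmult_plus_distr_l, IH.
    replace (INR (S (S n)) * t) with (INR (S n) * t + t)
      by (rewrite (S_INR (S n)); ring).
    rewrite cis_plus; ring.
Qed.

(** For [j <> l] the terms form a geometric progression over a full period of
    a root of unity different from 1, so the sum telescopes to 0. *)
Lemma cis_orthogonal (n j l : nat) : (j <= n)%nat -> (l <= n)%nat ->
  sum_n (fun k => Cmult (cis (- (INR j * freq n k)))
                        (Cconj (cis (- (INR l * freq n k))))) n
  = if Nat.eqb j l then RtoC (INR (S n)) else RtoC 0.
Proof.
  intros Hj Hl.
  assert (HP : 0 < INR (S n)) by (apply lt_0_INR; lia).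
  set (t := 2 * PI * (INR l - INR j) / INR (S n)).
  rewrite (sum_n_ext _ (fun k => cis (INR k * t))).
  2:{ intro k; rewrite <- cis_opp, Ropp_involutive, <- cis_plus; f_equal.
      unfold t, freq; field; lra. }
  destruct (Nat.eqb_spec j l) as [E|E].
  - rewrite (sum_n_ext _ (fun _ => RtoC 1)).
    2:{ intro k; unfold t; rewrite E.
        replace (INR k * (2 * PI * (INR l - INR l) / INR (S n))) with 0
          by (field; lra).
        apply cis_0. }
    rewrite <- sum_n_RtoC, sum_n_const; f_equal; ring.
  - assert (Hd : 1 <= Rabs (INR l - INR j) < INR (S n)).
    { destruct (Nat.lt_total j l) as [H|[H|H]]; [|easy|].
      - rewrite <- minus_INR, Rabs_pos_eq by (try apply pos_INR; lia).
        split; [apply (le_INR 1)|apply lt_INR]; lia.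
      - rewrite Rabs_minus_sym, <- minus_INR, Rabs_pos_eq
          by (try apply pos_INR; lia).
        split; [apply (le_INR 1)|apply lt_INR]; lia. }
    assert (Hne : cis t <> RtoC 1).
    { apply cis_neq_1. unfold t, Rdiv.
      pose proof PI_RGT_0.
      assert (H2 : 0 < / INR (S n)) by (apply Rinv_0_lt_compat; lra).
      rewrite !Rabs_mult, (Rabs_pos_eq (/ INR (S n))), (Rabs_pos_eq 2),
        (Rabs_pos_eq PI) by lra.
      assert (Hi : INR (S n) * / INR (S n) = 1) by (field; lra).
      assert (H3 : Rabs (INR l - INR j) * / INR (S n) < 1)
        by (rewrite <- Hi; apply Rmult_lt_compat_r; lra).
      assert (H4 : 0 < Rabs (INR l - INR j) * / INR (S n))
        by (apply Rmult_lt_0_compat; lra).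
      rewrite Rmult_assoc; split; nra. }
    pose proof (cis_geometric t n) as G.
    replace (INR (S n) * t) with (2 * PI * INR l + - (2 * PI * INR j)) in G
      by (unfold t; field; lra).
    rewrite cis_plus, cis_opp, !cis_2PI_mult in G.
    destruct (Ceq_dec (sum_n (fun k => cis (INR k * t)) n) (RtoC 0)) as [H|H];
      [exact H|].
    exfalso; apply (Cmult_neq_0 _ _ (Cminus_eq_contra _ _ Hne) H).
    rewrite G. apply injective_projections; simpl; ring.
Qed.

Definition dft (X : HilbertSpace) (n : nat) (v : nat -> X) (k : nat) : X :=
  sum_n (fun j => scal (cis (- (INR j * freq n k))) (v j)) n.

(** Expanding the squares into inner products and summing first over the
    frequency [k] leaves only the diagonal terms, by orthogonality. *)
Lemma dft_parseval (X : HilbertSpace) (n : nat) (v : nat -> X) :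
  sum_n (fun k => norm (dft X n v k) ^ 2) n
  = INR (S n) * sum_n (fun j => norm (v j) ^ 2) n.
Proof.
  apply RtoC_inj.
  rewrite RtoC_mult, !sum_n_RtoC.
  set (e := fun j k => cis (- (INR j * freq n k))).
  rewrite (sum_n_ext _ (fun k => sum_n (fun j => sum_n (fun l =>
    Cmult (Cmult (e j k) (Cconj (e l k))) (inner (v j) (v l))) n) n)).
  2:{ intro k; rewrite <- inner_norm; unfold dft; rewrite inner_sum_l.
      apply sum_n_ext; intro j; rewrite inner_sum_r.
      apply sum_n_ext; intro l; rewrite inner_scal_l, inner_scal_r.
      unfold e; C_ring. }
  rewrite sum_n_switch.
  rewrite <- (sum_n_mult_l (RtoC (INR (S n)) : C_Ring)).
  apply sum_n_ext_loc; intros j Hj.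
  rewrite sum_n_switch.
  rewrite (sum_n_ext_loc _ (fun l => if Nat.eqb j l then
     Cmult (RtoC (INR (S n))) (RtoC (norm (v l) ^ 2)) else RtoC 0)).
  - exact (sum_n_delta _ j n
      (fun l => Cmult (RtoC (INR (S n))) (RtoC (norm (v l) ^ 2)) : C_Ring) Hj).
  - intros l Hl.
    etransitivity.
    { exact (sum_n_mult_r (inner (v j) (v l) : C_Ring)
       (fun k => Cmult (e j k) (Cconj (e l k))) n). }
    unfold e; rewrite cis_orthogonal by assumption.
    destruct (Nat.eqb_spec j l) as [<-|_].
    + now rewrite inner_norm.
    + exact (Cmult_0_l _).
Qed.

Lemma sum_n_shift (G : AbelianGroup) (g : nat -> G) (n : nat) :
  g (S n) = g 0%nat -> sum_n (fun j => g (S j)) n = sum_n g n.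
Proof.
  intro H. apply (plus_reg_l (g 0%nat)).
  rewrite (plus_comm _ (sum_n g n)), <- H, <- sum_Sn, H.
  clear H; induction n as [|n IH].
  - now rewrite sum_Sn, !sum_O.
  - now rewrite (sum_Sn _ n), plus_assoc, IH, <- sum_Sn.
Qed.

Lemma dft_plus (X : HilbertSpace) (n : nat) (u v : nat -> X) (k : nat) :
  dft X n (fun j => plus (u j) (v j)) k = plus (dft X n u k) (dft X n v k).
Proof.
  unfold dft; rewrite <- sum_n_plus; apply sum_n_ext; intro j.
  exact (scal_distr_l _ _ _).
Qed.

Lemma dft_scal (X : HilbertSpace) (n : nat) (c : C) (u : nat -> X) (k : nat) :
  dft X n (fun j => scal c (u j)) k = scal c (dft X n u k).
Proof.
  unfold dft.
  etransitivity; [|exact (sum_n_scal_l (V := CompleteNormedModule.ModuleSpace _ X) _ _ _)].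
  apply sum_n_ext; intro j. hilbert_eq.
Qed.

Lemma dft_shift (X : HilbertSpace) (n : nat) (u : nat -> X) (k : nat) : u (S n) = u 0%nat ->
  dft X n (fun j => u (S j)) k = scal (cis (freq n k)) (dft X n u k).
Proof.
  intro Hu. unfold dft.
  set (t := freq n k).
  rewrite <- (sum_n_shift _ (fun j => scal (cis (- (INR j * t))) (u j))).
  2:{ rewrite Hu; f_equal.
      replace (- (INR (S n) * t)) with (- (2 * PI * INR k)).
      2:{ unfold t, freq; field. apply not_0_INR; lia. }
      rewrite cis_opp, cis_2PI_mult.
      replace (- (INR 0 * t)) with 0 by (simpl; ring).
      rewrite cis_0. apply injective_projections; simpl; ring. }
  etransitivity; [|exact (sum_n_scal_l (V := CompleteNormedModule.ModuleSpace _ X) _ _ _)].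
  apply sum_n_ext; intro j.
  replace (- (INR j * t)) with (t + - (INR (S j) * t))
    by (rewrite S_INR; ring).
  rewrite cis_plus. hilbert_eq.
Qed.

(** The transform is a finite linear combination, so additivity of [A] on its
    domain suffices to exchange the two. *)
Lemma dft_op (X : HilbertSpace) (n : nat) (A : LinOp X) (u : nat -> X) (k : nat) :
  (forall j, dom A (u j)) ->
  dom A (dft X n u k) /\ op A (dft X n u k) = dft X n (fun j => op A (u j)) k.
Proof.
  intro Hu. unfold dft. set (e := fun j => cis (- (INR j * freq n k))).
  change (dom A (sum_n (fun j => scal (e j) (u j)) n) /\
    op A (sum_n (fun j => scal (e j) (u j)) n)
    = sum_n (fun j => scal (e j) (op A (u j))) n).
  generalize n; intro m.
  assert (Hs : forall j, dom A (scal (e j) (u j)))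
    by (intro j; apply (dom_scal (l := A)), Hu).
  induction m as [|m [IHd IH]].
  - rewrite !sum_O; split; [apply Hs|]. exact (op_scal _ (Hu _)).
  - rewrite !sum_Sn; split; [exact (dom_plus IHd (Hs _))|].
    rewrite <- IH, <- (op_scal (e (S m)) (Hu (S m))). exact (op_plus IHd (Hs _)).
Qed.

(** * Resolvent estimate for the midpoint scheme *)

Lemma cis_sub_1 (t : R) :
  Cminus (cis t) (RtoC 1) = Cmult (Cmult Ci (RtoC (2 * sin (t / 2)))) (cis (t / 2)).
Proof.
  assert (Ht : t = 2 * (t / 2)) by field.
  pose proof (sin2_cos2 (t / 2)) as H; unfold Rsqr in H.
  unfold cis; rewrite Ht at 1 2; rewrite sin_2a, cos_2a.
  apply injective_projections; simpl; nra.
Qed.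

Lemma cis_add_1 (t : R) :
  Cplus (RtoC 1) (cis t) = Cmult (RtoC (2 * cos (t / 2))) (cis (t / 2)).
Proof.
  assert (Ht : t = 2 * (t / 2)) by field.
  pose proof (sin2_cos2 (t / 2)) as H; unfold Rsqr in H.
  unfold cis; rewrite Ht at 1 2; rewrite sin_2a, cos_2a.
  apply injective_projections; simpl; nra.
Qed.

(** The form in which the resolvent bound enters: it needs only vectors of the
    domain and no inverse operator. *)
Definition lower_bound_on_iR (X : NormedModule C_AbsRing) (A : LinOp X) (mu : R) : Prop :=
  forall (lambda : R) (x : X), dom A x ->
  norm x <= / mu * norm (minus (scal (Cmult Ci (RtoC lambda)) x) (op A x)).

Definition midpoint (X : HilbertSpace) (u : nat -> X) (j : nat) : X :=
  scal (RtoC (/ 2)) (plus (u j) (u (S j))).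

(** The residual of the implicit midpoint scheme for [u' = A u] with step [h].
    This scheme is used because its symbol maps the unit circle onto the
    imaginary axis, where the resolvent is controlled. *)
Definition defect (X : HilbertSpace) (A : LinOp X) (h : R) (u : nat -> X) (j : nat) : X :=
  minus (scal (RtoC (/ h)) (minus (u (S j)) (u j))) (op A (midpoint X u j)).

(** At frequency angle [t] the transforms satisfy
    [(i lambda - A) W = F] with [lambda = (2/h) tan(t/2)] real, for [W] that of
    the midpoints and [F] that of the defect; at the exceptional angle where
    [cos(t/2) = 0] the factor [1 + exp(i t)] makes [W] vanish. The lower bound then
    holds frequency by frequency, uniformly in [h], and Parseval's identity
    sums it. *)
Lemma midpoint_le_defect (X : HilbertSpace) (A : LinOp X) (mu h : R) (n : nat)
    (u : nat -> X) :
  lower_bound_on_iR X A mu -> 0 < mu -> 0 < h ->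
  (forall j, dom A (u j)) -> u (S n) = u 0%nat ->
  sum_n (fun j => norm (midpoint X u j) ^ 2) n
  <= / mu ^ 2 * sum_n (fun j => norm (defect X A h u j) ^ 2) n.
Proof.
  intros Hco Hmu Hh Hu Hper.
  assert (Hmid : forall j, dom A (midpoint X u j))
    by (intro j; apply (dom_scal (l := A)), dom_plus; apply Hu).
  assert (HP : 0 < INR (S n)) by (apply lt_0_INR; lia).
  apply (Rmult_le_reg_l (INR (S n))); [exact HP|].
  replace (INR (S n) * (/ mu ^ 2 * sum_n (fun j => norm (defect X A h u j) ^ 2) n))
    with (/ mu ^ 2 * (INR (S n) * sum_n (fun j => norm (defect X A h u j) ^ 2) n))
    by ring.
  rewrite <- !dft_parseval.
  rewrite <- (sum_n_mult_l (/ mu ^ 2 : R_Ring)).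
  apply sum_n_m_le; intro k.
  change (norm (dft X n (midpoint X u) k) ^ 2
    <= / mu ^ 2 * norm (dft X n (defect X A h u) k) ^ 2).
  set (V := dft X n u k). set (t := freq n k).
  destruct (dft_op X n A (midpoint X u) k Hmid) as [Wd WA].
  set (W := dft X n (midpoint X u) k) in *.
  set (F := dft X n (defect X A h u) k).
  assert (HW : W = scal (Cmult (RtoC (/ 2)) (Cplus (RtoC 1) (cis t))) V).
  { unfold W, midpoint.
    rewrite dft_scal, dft_plus, dft_shift by exact Hper.
    fold t V. hilbert_eq. }
  assert (HF : F = minus (scal (Cmult (RtoC (/ h)) (Cminus (cis t) (RtoC 1))) V)
                         (op A W)).
  { transitivity (plus (scal (RtoC (/ h)) (plus (scal (cis t) V)
        (scal (Copp (RtoC 1)) V))) (scal (Copp (RtoC 1)) (op A W))).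
    - rewrite WA. unfold V, t; rewrite <- (dft_shift X n u k Hper).
      transitivity (dft X n (fun j => plus (scal (RtoC (/ h))
        (plus (u (S j)) (scal (Copp (RtoC 1)) (u j))))
        (scal (Copp (RtoC 1)) (op A (midpoint X u j)))) k).
      + unfold F, dft; apply sum_n_ext; intro j; f_equal.
        unfold defect; hilbert_eq.
      + now rewrite dft_plus, !dft_scal, dft_plus, dft_scal.
    - hilbert_eq. }
  rewrite cis_add_1 in HW. rewrite cis_sub_1 in HF.
  destruct (Req_dec (cos (t / 2)) 0) as [Hc|Hc].
  - rewrite Hc in HW.
    assert (HW0 : norm W = 0).
    { assert (E : W = zero).
      { rewrite HW. apply inner_ext; intro z; inner_simpl.
        apply injective_projections; simpl; ring. }
      rewrite E. exact (@norm_zero _ (CompleteNormedModule.NormedModule _ X)). }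
    rewrite HW0. assert (0 < / mu ^ 2) by (apply Rinv_0_lt_compat; nra). nra.
  - pose proof (Hco (2 / h * (sin (t / 2) / cos (t / 2))) W Wd) as B.
    assert (E : F = minus (scal (Cmult Ci
      (RtoC (2 / h * (sin (t / 2) / cos (t / 2))))) W) (op A W)).
    { rewrite HF. f_equal. rewrite HW. unfold Rdiv at 3.
      etransitivity; [|symmetry; exact (scal_assoc _ _ _)].
      f_equal. apply injective_projections; simpl; field; split; lra. }
    assert (0 <= norm W) by apply norm_ge_0.
    replace (/ mu ^ 2 * norm F ^ 2) with ((/ mu * norm F) ^ 2) by (field; lra).
    apply pow_incr; split; [exact H|rewrite E; exact B].
Qed.

(** * Operator norms, resolvents and generators *)

Lemma norm_scal_RtoC (X : NormedModule C_AbsRing) (a : R) (x : X) :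
  norm (scal (RtoC a) x) <= Rabs a * norm x.
Proof. rewrite <- Cmod_R; exact (@norm_scal C_AbsRing X (RtoC a) x). Qed.

Lemma op_norm_bound (X : NormedModule C_AbsRing) (T : X -> X) (c : R) :
  (forall (a : C) (x : X), T (scal a x) = scal a (T x)) ->
  Rbar_le (op_norm T) (Finite c) -> forall x : X, norm (T x) <= c * norm x.
Proof.
  intros HT Hc x.
  destruct (Lub_Rbar_correct (fun r : R => exists x : X,
    norm x <= 1 /\ r = norm (T x))) as [Hub _].
  assert (Hu : forall y : X, norm y <= 1 -> norm (T y) <= c).
  { intros y Hy. apply (Rbar_le_trans (Finite _) (op_norm T) (Finite _)); [|exact Hc].
    apply Hub; now exists y. }
  destruct (Req_dec (norm x) 0) as [E|E].
  - assert (Tx : T x = zero).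
    { transitivity (T (scal (zero : C_AbsRing) x)).
      - f_equal. symmetry. apply norm_eq_zero in E; rewrite E.
        exact (scal_zero_r _).
      - rewrite HT. exact (scal_zero_l _). }
    rewrite Tx, norm_zero, E. lra.
  - pose proof (norm_ge_0 x) as H0.
    assert (Hx : scal (RtoC (norm x)) (scal (RtoC (/ norm x)) x) = x).
    { rewrite scal_assoc.
      replace (mult (RtoC (norm x)) (RtoC (/ norm x))) with (one : C_AbsRing).
      - apply scal_one.
      - apply injective_projections; simpl; field; lra. }
    rewrite <- Hx at 1. rewrite HT.
    eapply Rle_trans; [apply norm_scal_RtoC|].
    rewrite Rabs_pos_eq, Rmult_comm by assumption.
    apply Rmult_le_compat_r; [assumption|]. apply Hu.
    eapply Rle_trans; [apply norm_scal_RtoC|].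
    rewrite Rabs_pos_eq by (apply Rlt_le, Rinv_0_lt_compat; lra).
    right; field; assumption.
Qed.

Lemma op_norm_le (X : NormedModule C_AbsRing) (T : X -> X) (c : R) :
  (forall x : X, norm x <= 1 -> norm (T x) <= c) ->
  Rbar_le (op_norm T) (Finite c).
Proof.
  intro H.
  destruct (Lub_Rbar_correct (fun r : R => exists x : X,
    norm x <= 1 /\ r = norm (T x))) as [_ Hl].
  apply Hl. intros r [x [Hx ->]]. now apply H.
Qed.

Lemma resolvent_lower_bound (X : HilbertSpace) (A : LinOp X) (mu : R) :
  (forall lambda : R, exists S : X -> X,
     is_resolvent A (Cmult Ci (RtoC lambda)) S /\
     Rbar_le (op_norm S) (Finite (/ mu))) ->
  lower_bound_on_iR X A mu.
Proof.
  intros H lambda x Hx.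
  destruct (H lambda) as [S [[HS1 HS2] HS]].
  rewrite <- (HS2 x Hx) at 1.
  apply op_norm_bound; [|exact HS].
  intros a y. destruct (HS1 y) as [Hd Hy].
  rewrite <- Hy at 1.
  rewrite <- (HS2 _ (dom_scal a Hd)). f_equal.
  rewrite (op_scal a Hd). hilbert_eq.
Qed.

(** The difference quotient at [T t x] is the image under the bounded operator
    [T t] of the difference quotient at [x]. *)
Lemma generator_commutes (X : HilbertSpace) (A : LinOp X) (T : R -> X -> X)
    (t : R) (x : X) :
  generates A T -> 0 <= t -> dom A x ->
  dom A (T t x) /\ op A (T t x) = T t (op A x).
Proof.
  intros [HT Hg] Ht Hx.
  apply (Hg (T t x) (T t (op A x))).
  destruct (Hg x (op A x)) as [Hlim _].
  specialize (Hlim (conj Hx eq_refl)).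
  apply (filterlim_ext_loc (fun h => T t (scal (RtoC (/ h)) (minus (T h x) x)))).
  - exists (mkposreal 1 Rlt_0_1); intros h _ Hh.
    rewrite (linear_scal _ (sg_linear HT Ht)).
    f_equal. etransitivity; [exact (linear_minus _ _ _ (sg_linear HT Ht))|].
    now rewrite <- (sg_add HT), Rplus_comm, (sg_add HT) by lra.
  - eapply filterlim_comp; [exact Hlim|].
    exact (linear_cont (V := CompleteNormedModule.NormedModule _ X) (T t) (op A x) (sg_linear HT Ht)).
Qed.

Lemma at_right_norm_le (X : NormedModule C_AbsRing) (f : R -> X) (y : X) (eps : R) :
  filterlim f (at_right 0) (locally y) -> 0 < eps ->
  exists d : R, 0 < d /\ forall h, 0 < h < d -> norm (minus (f h) y) <= eps.
Proof.
  intros Hf He.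
  destruct (proj1 (filterlim_locally_ball_norm f y) Hf (mkposreal eps He)) as [d Hd].
  exists d; split; [apply cond_pos|]. intros h Hh.
  apply Rlt_le, (Hd h); [|lra].
  change (Rabs (h - 0) < d). rewrite Rminus_0_r, Rabs_pos_eq; lra.
Qed.

(** * Energy inequality along weighted trajectories *)

Lemma norm_comb3 (X : NormedModule C_AbsRing) (a b c ra rb rc : R) (x y z : X) :
  Rabs a <= ra -> Rabs b <= rb -> Rabs c <= rc ->
  norm (plus (scal (RtoC a) x) (plus (scal (RtoC b) y) (scal (RtoC c) z)))
  <= ra * norm x + rb * norm y + rc * norm z.
Proof.
  intros Ha Hb Hc.
  eapply Rle_trans; [exact (@norm_triangle C_AbsRing X _ _)|].
  eapply Rle_trans;
    [apply Rplus_le_compat_l; exact (@norm_triangle C_AbsRing X _ _)|].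
  pose proof (norm_scal_RtoC X a x). pose proof (norm_scal_RtoC X b y).
  pose proof (norm_scal_RtoC X c z).
  pose proof (Rmult_le_compat_r _ _ _ (norm_ge_0 x) Ha).
  pose proof (Rmult_le_compat_r _ _ _ (norm_ge_0 y) Hb).
  pose proof (Rmult_le_compat_r _ _ _ (norm_ge_0 z) Hc).
  lra.
Qed.

Lemma norm_scal_sqr (X : HilbertSpace) (a : R) (x : X) :
  norm (scal (RtoC a) x) ^ 2 = a ^ 2 * norm x ^ 2.
Proof.
  apply RtoC_inj. rewrite RtoC_mult, <- !inner_norm, inner_scal_l, inner_scal_r.
  apply injective_projections; simpl; ring.
Qed.

Lemma Rabs_norm_sub (X : NormedModule C_AbsRing) (x y : X) (e : R) :
  norm (minus x y) <= e -> Rabs (norm x - norm y) <= e.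
Proof. intro H; eapply Rle_trans; [apply norm_triangle_inv|exact H]. Qed.

(** Consistency of the midpoint scheme on [u_j = chi_j T(j h) x]. By the
    semigroup law and linearity both differences are [T(j h)] applied to a
    combination, with coefficients controlled by [B], of vectors that do not
    depend on [j]: the remainders of the difference quotients at [x] and of the
    continuity at [x] and [A x], and [x] and [A x] themselves with increments of
    [chi], of order [h], in front. This makes the error uniform in [j]. *)
Lemma trajectory_defect (X : HilbertSpace) (A : LinOp X) (T : R -> X -> X)
    (M B s h : R) (chi : nat -> R) (x : X) :
  generates A T -> 0 <= M ->
  (forall t y, 0 <= t -> norm (T t y) <= M * norm y) -> dom A x ->
  0 < h <= s -> 0 <= B ->
  norm (minus (T h x) x) <= s ->
  norm (minus (T h (op A x)) (op A x)) <= s ->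
  norm (minus (scal (RtoC (/ h)) (minus (T h x) x)) (op A x)) <= s ->
  (forall j, Rabs (chi j) <= B) ->
  (forall j, Rabs (chi (S j) - chi j) <= B * h) ->
  let u := fun j => scal (RtoC (chi j)) (T (INR j * h) x) in
  forall j,
  norm (minus (midpoint X u j) (u j)) <= B * M * (2 + norm x + norm (op A x)) * s /\
  norm (minus (defect X A h u j)
     (scal (RtoC ((chi (S j) - chi j) / h)) (T (INR j * h) x)))
    <= B * M * (2 + norm x + norm (op A x)) * s.
Proof.
  intros Hg HM HT Hx Hh HB H1 H2 H3 Hchi Hdchi u j.
  assert (Hj : 0 <= INR j * h) by (pose proof (pos_INR j); nra).
  pose proof (sg_linear (proj1 Hg) Hj) as Hl.
  set (L := T (INR j * h)) in *.
  assert (HS : forall y, T (INR (S j) * h) y = L (T h y)).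
  { intro y. rewrite S_INR. replace ((INR j + 1) * h) with (INR j * h + h) by ring.
    unfold L. apply (sg_add (proj1 Hg)); lra. }
  assert (HSj : 0 <= INR (S j) * h) by (pose proof (pos_INR (S j)); nra).
  assert (HopA : op A (midpoint X u j) = scal (RtoC (/ 2)) (plus
     (scal (RtoC (chi j)) (L (op A x)))
     (scal (RtoC (chi (S j))) (L (T h (op A x)))))).
  { destruct (generator_commutes _ _ _ _ _ Hg Hj Hx) as [D1 E1].
    destruct (generator_commutes _ _ _ _ _ Hg HSj Hx) as [D2 E2].
    unfold midpoint, u.
    rewrite op_scal by (apply dom_plus; apply (dom_scal (l := A)); assumption).
    rewrite op_plus by (apply (dom_scal (l := A)); assumption).
    rewrite !op_scal by assumption. rewrite E1, E2, HS. reflexivity. }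
  assert (bnd : forall y, norm (L y) <= M * norm y) by (intro y; now apply HT).
  set (r := minus (scal (RtoC (/ h)) (minus (T h x) x)) (op A x)) in *.
  assert (Er : L r = minus (scal (RtoC (/ h)) (minus (L (T h x)) (L x))) (L (op A x))).
  { etransitivity; [exact (linear_minus L _ _ Hl)|]. f_equal.
    etransitivity; [exact (linear_scal _ Hl _ _)|]. f_equal.
    exact (linear_minus L _ _ Hl). }
  assert (Ed : L (minus (T h x) x) = minus (L (T h x)) (L x))
    by exact (linear_minus L _ _ Hl).
  assert (Ea : L (minus (T h (op A x)) (op A x)) = minus (L (T h (op A x))) (L (op A x)))
    by exact (linear_minus L _ _ Hl).
  pose proof (bnd r) as B1. pose proof (bnd (minus (T h x) x)) as B2.
  pose proof (bnd (minus (T h (op A x)) (op A x))) as B3.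
  pose proof (bnd x) as B4. pose proof (bnd (op A x)) as B5.
  pose proof (Hchi (S j)) as C1. pose proof (Hdchi j) as C2.
  pose proof (norm_ge_0 x) as N1. pose proof (norm_ge_0 (op A x)) as N2.
  assert (HBM : 0 <= B * M) by nra.
  assert (Hb : Rabs (chi (S j) / 2) <= B).
  { unfold Rdiv; rewrite Rabs_mult, (Rabs_pos_eq (/ 2)) by lra.
    pose proof (Rabs_pos (chi (S j))); lra. }
  assert (Hd : Rabs ((chi (S j) - chi j) / 2) <= B * s).
  { unfold Rdiv; rewrite Rabs_mult, (Rabs_pos_eq (/ 2)) by lra.
    pose proof (Rabs_pos (chi (S j) - chi j)); nra. }
  assert (Hb' : Rabs (- (chi (S j) / 2)) <= B) by now rewrite Rabs_Ropp.
  assert (P1 : B * norm (L (minus (T h x) x)) <= B * M * s) by nra.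
  assert (P2 : B * norm (L (minus (T h (op A x)) (op A x))) <= B * M * s) by nra.
  assert (P3 : B * norm (L r) <= B * M * s) by nra.
  assert (P4 : B * s * norm (L x) <= B * s * (M * norm x))
    by (apply Rmult_le_compat_l; nra).
  assert (P5 : B * s * norm (L (op A x)) <= B * s * (M * norm (op A x)))
    by (apply Rmult_le_compat_l; nra).
  assert (Q1 : 0 <= B * M * s) by nra.
  assert (Q2 : 0 <= B * M * s * norm x) by nra.
  assert (Q3 : 0 <= B * M * s * norm (op A x)) by nra.
  split.
  - assert (E : minus (midpoint X u j) (u j) =
      plus (scal (RtoC (chi (S j) / 2)) (L (minus (T h x) x)))
      (plus (scal (RtoC ((chi (S j) - chi j) / 2)) (L x)) (scal (RtoC 0) (L x)))).
    { rewrite Ed. unfold midpoint, u. rewrite HS. fold L.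
      apply inner_ext; intro z; inner_simpl.
      apply injective_projections; simpl; field. }
    rewrite E.
    eapply Rle_trans.
    + exact (norm_comb3 X _ _ _ B (B * s) 0 _ _ _ Hb Hd (Req_le _ _ Rabs_R0)).
    + nra.
  - assert (E : minus (defect X A h u j)
       (scal (RtoC ((chi (S j) - chi j) / h)) (L x)) =
      plus (scal (RtoC (chi (S j))) (L r))
      (plus (scal (RtoC (- (chi (S j) / 2))) (L (minus (T h (op A x)) (op A x))))
       (scal (RtoC ((chi (S j) - chi j) / 2)) (L (op A x))))).
    { rewrite Er, Ea. unfold defect. rewrite HopA. unfold u. rewrite HS. fold L.
      apply inner_ext; intro z; inner_simpl.
      apply injective_projections; simpl; field; lra. }
    rewrite E.
    eapply Rle_trans.
    + exact (norm_comb3 X _ _ _ B B (B * s) _ _ _ C1 Hb' Hd).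
    + nra.
Qed.

Lemma sum_n_affine (a b : nat -> R) (c e : R) (n : nat) :
  sum_n (fun j => c * a j - b j + e) n
  = c * sum_n a n - sum_n b n + e * INR (S n).
Proof.
  induction n as [|n IH]; [rewrite !sum_O; simpl; ring|].
  rewrite !sum_Sn, IH, (S_INR (S n)). unfold plus; cbn -[INR]. ring.
Qed.

(** The discrete energy inequality for [chi T x]. The error is a small
    multiple of the number of terms, uniformly over the weights with given bound
    and Lipschitz constant, so the weight may be chosen after the step. *)
Lemma weighted_trajectory_estimate (X : HilbertSpace) (A : LinOp X)
    (T : R -> X -> X) (mu M B eps : R) (x : X) :
  generates A T -> 0 < mu -> 0 <= M -> 0 <= B -> 0 < eps ->
  (forall t y, 0 <= t -> norm (T t y) <= M * norm y) ->
  lower_bound_on_iR X A mu -> dom A x ->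
  exists h0 : R, 0 < h0 /\ forall (h : R) (n : nat) (chi : nat -> R),
    0 < h < h0 -> chi 0%nat = 0 -> chi (S n) = 0 ->
    (forall j, Rabs (chi j) <= B) ->
    (forall j, Rabs (chi (S j) - chi j) <= B * h) ->
    sum_n (fun j => (mu ^ 2 * chi j ^ 2 - ((chi (S j) - chi j) / h) ^ 2)
                    * norm (T (INR j * h) x) ^ 2) n
    <= eps * INR (S n).
Proof.
  intros Hg Hmu HM HB Heps HT Hco Hx.
  pose proof (norm_ge_0 x) as N1. pose proof (norm_ge_0 (op A x)) as N2.
  set (K := B * M * norm x).
  set (D := B * M * (2 + norm x + norm (op A x))).
  set (Q := 2 * mu ^ 2 * K + 2 * K + 1).
  assert (HK : 0 <= K) by (unfold K; repeat apply Rmult_le_pos; lra).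
  assert (HD : 0 <= D) by (unfold D; repeat apply Rmult_le_pos; lra).
  assert (HQ : 1 <= Q) by (unfold Q; nra).
  (* [eta] bounds the consistency error; [eta <= 1] lets [eta * Q] dominate
     the error of the squares, which is quadratic in [eta]. *)
  set (eta := Rmin 1 (eps / Q)).
  assert (Heta : 0 < eta <= 1).
  { unfold eta; split; [|apply Rmin_l].
    apply Rmin_pos; [lra|]. apply Rdiv_lt_0_compat; lra. }
  assert (HetaQ : eta * Q <= eps).
  { apply Rle_trans with (eps / Q * Q); [|right; field; lra].
    apply Rmult_le_compat_r; [lra|apply Rmin_r]. }
  set (s := eta / (D + 1)).
  assert (Hs : 0 < s) by (apply Rdiv_lt_0_compat; lra).
  assert (HDs : D * s <= eta).
  { assert ((D + 1) * s = eta) by (unfold s; field; lra). nra. }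
  destruct (at_right_norm_le X _ x s (sg_cont (x := x) (proj1 Hg)) Hs) as [d1 [Hd1 E1]].
  destruct (at_right_norm_le X _ (op A x) s (sg_cont (x := op A x) (proj1 Hg)) Hs)
    as [d2 [Hd2 E2]].
  destruct (at_right_norm_le X _ (op A x) s
    (proj1 (proj2 Hg x (op A x)) (conj Hx eq_refl)) Hs) as [d3 [Hd3 E3]].
  exists (Rmin s (Rmin d1 (Rmin d2 d3))). split; [now repeat apply Rmin_pos|].
  intros h n chi Hh Hc0 Hcn Hchi Hdchi.
  assert (Hhs : h < s /\ h < d1 /\ h < d2 /\ h < d3).
  { destruct Hh as [_ Hh].
    pose proof (Rmin_l s (Rmin d1 (Rmin d2 d3))).
    pose proof (Rmin_r s (Rmin d1 (Rmin d2 d3))).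
    pose proof (Rmin_l d1 (Rmin d2 d3)). pose proof (Rmin_r d1 (Rmin d2 d3)).
    pose proof (Rmin_l d2 d3). pose proof (Rmin_r d2 d3). lra. }
  set (u := fun j => scal (RtoC (chi j)) (T (INR j * h) x)).
  set (g := fun j => scal (RtoC ((chi (S j) - chi j) / h)) (T (INR j * h) x)).
  assert (Herr : forall j, norm (minus (midpoint X u j) (u j)) <= eta /\
     norm (minus (defect X A h u j) (g j)) <= eta).
  { intro j.
    destruct (trajectory_defect X A T M B s h chi x Hg HM HT Hx) with (j := j)
      as [F1 F2]; try assumption; try lra.
    - apply E1; lra.
    - apply E2; lra.
    - apply E3; lra.
    - split; (eapply Rle_trans; [eassumption|exact HDs]). }
  assert (Hj : forall j, 0 <= INR j * h) by (intro j; pose proof (pos_INR j); nra).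
  assert (HTj : forall j, 0 <= norm (T (INR j * h) x) <= M * norm x)
    by (intro j; split; [apply norm_ge_0|now apply HT]).
  assert (Hu : forall j, 0 <= norm (u j) <= K).
  { intro j; split; [apply norm_ge_0|].
    eapply Rle_trans; [apply norm_scal_RtoC|]. unfold K; rewrite Rmult_assoc.
    apply Rmult_le_compat; [apply Rabs_pos|apply norm_ge_0|apply Hchi|apply HTj]. }
  assert (Hgj : forall j, 0 <= norm (g j) <= K).
  { intro j; split; [apply norm_ge_0|].
    eapply Rle_trans; [apply norm_scal_RtoC|]. unfold K; rewrite Rmult_assoc.
    apply Rmult_le_compat; [apply Rabs_pos|apply norm_ge_0| |apply HTj].
    unfold Rdiv; rewrite Rabs_mult, Rabs_inv, (Rabs_pos_eq h) by lra.
    apply (Rmult_le_reg_r h); [lra|]. rewrite Rmult_assoc, Rinv_l, Rmult_1_r by lra.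
    apply Hdchi. }
  assert (Hdom : forall j, dom A (u j)).
  { intro j. apply (dom_scal (l := A)).
    exact (proj1 (generator_commutes X A T _ x Hg (Hj j) Hx)). }
  assert (Hper : u (S n) = u 0%nat).
  { unfold u. rewrite Hc0, Hcn. apply inner_ext; intro z; inner_simpl.
    apply injective_projections; simpl; ring. }
  pose proof (midpoint_le_defect X A mu h n u Hco Hmu (proj1 Hh) Hdom Hper) as Hkey.
  apply Rle_trans with (sum_n (fun j =>
    mu ^ 2 * norm (midpoint X u j) ^ 2 - norm (defect X A h u j) ^ 2 + eps) n).
  - apply sum_n_m_le; intro j.
    rewrite Rmult_minus_distr_r, Rmult_assoc.
    replace (chi j ^ 2 * norm (T (INR j * h) x) ^ 2) with (norm (u j) ^ 2)
      by apply norm_scal_sqr.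
    replace (((chi (S j) - chi j) / h) ^ 2 * norm (T (INR j * h) x) ^ 2)
      with (norm (g j) ^ 2) by apply norm_scal_sqr.
    destruct (Herr j) as [F1 F2].
    apply Rabs_norm_sub, Rabs_le_between in F1.
    apply Rabs_norm_sub, Rabs_le_between in F2.
    specialize (Hu j); specialize (Hgj j).
    pose proof (norm_ge_0 (midpoint X u j)) as N3.
    pose proof (norm_ge_0 (defect X A h u j)) as N4.
    set (a := norm (midpoint X u j)) in *. set (b := norm (u j)) in *.
    set (c := norm (defect X A h u j)) in *. set (d := norm (g j)) in *.
    assert (I1 : b ^ 2 <= a ^ 2 + 2 * eta * K).
    { destruct (Rle_dec b eta); nra. }
    assert (I2 : c ^ 2 <= d ^ 2 + (2 * K + 1) * eta) by nra.
    assert (I3 : mu ^ 2 * b ^ 2 <= mu ^ 2 * (a ^ 2 + 2 * eta * K))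
      by (apply Rmult_le_compat_l; nra).
    unfold Q in HetaQ. nra.
  - rewrite sum_n_affine.
    apply Rmult_le_compat_l with (r := mu ^ 2) in Hkey; [|nra].
    rewrite <- Rmult_assoc, Rinv_r, Rmult_1_l in Hkey by nra. lra.
Qed.

(** * The weight *)

(** Time is counted in steps of length [1/(mu n)]: [n] linear steps from 0 to 1,
    then [q] exponential ones, then a constant. The factor [1 + 1/n] makes the
    discrete slope of the exponential part exactly [mu] times the value. *)
Definition ramp (n q i : nat) : R :=
  INR (Nat.min i n) / INR n * (1 + / INR n) ^ Nat.min (i - n) q.

(** The ramp and its mirror image. Of the [3n + 2q] steps, those from [n + q] to
    [2n + q] form the plateau. *)
Definition bump (n q j : nat) : R := ramp n q (Nat.min j (3 * n + 2 * q - j)).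

Definition indic (a b j : nat) : R :=
  if (Nat.leb a j && Nat.ltb j b)%bool then 1 else 0.

Lemma sum_n_indic (a b n : nat) : (a <= b <= S n)%nat ->
  sum_n (indic a b) n = INR (b - a).
Proof.
  intro H.
  assert (G : forall k, sum_n (indic a b) k = INR (Nat.min b (S k) - a)).
  { induction k as [|k IH].
    - rewrite sum_O. unfold indic.
      destruct (Nat.leb_spec a 0); destruct (Nat.ltb_spec 0 b); simpl.
      + now replace (Nat.min b 1 - a)%nat with 1%nat by lia.
      + now replace (Nat.min b 1 - a)%nat with 0%nat by lia.
      + now replace (Nat.min b 1 - a)%nat with 0%nat by lia.
      + now replace (Nat.min b 1 - a)%nat with 0%nat by lia.
    - rewrite sum_Sn, IH. unfold indic.
      destruct (Nat.leb_spec a (S k)); destruct (Nat.ltb_spec (S k) b); simpl andb.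
      + replace (Nat.min b (S (S k)) - a)%nat
          with (S (Nat.min b (S k) - a))%nat by lia.
        now rewrite S_INR.
      + replace (Nat.min b (S (S k)) - a)%nat
          with (Nat.min b (S k) - a)%nat by lia. apply Rplus_0_r.
      + replace (Nat.min b (S (S k)) - a)%nat
          with (Nat.min b (S k) - a)%nat by lia. apply Rplus_0_r.
      + replace (Nat.min b (S (S k)) - a)%nat
          with (Nat.min b (S k) - a)%nat by lia. apply Rplus_0_r. }
  rewrite G; f_equal; lia.
Qed.

Lemma ramp_0 (n q : nat) : ramp n q 0 = 0.
Proof. unfold ramp; simpl INR; unfold Rdiv; ring. Qed.

Lemma ramp_linear_step (n q i : nat) : (0 < n)%nat -> (i < n)%nat ->
  ramp n q (S i) = ramp n q i + / INR n.
Proof.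
  intros Hn Hi. assert (0 < INR n) by now apply lt_0_INR.
  unfold ramp.
  replace (Nat.min (S i - n) q) with 0%nat by lia.
  replace (Nat.min (i - n) q) with 0%nat by lia.
  rewrite !Nat.min_l, S_INR by lia. simpl pow. field; lra.
Qed.

Lemma ramp_above (n q i : nat) : (0 < n)%nat -> (n <= i)%nat ->
  ramp n q i = (1 + / INR n) ^ Nat.min (i - n) q.
Proof.
  intros Hn Hi. assert (0 < INR n) by now apply lt_0_INR.
  unfold ramp. rewrite Nat.min_r by lia. field_simplify; lra.
Qed.

Lemma ramp_exp_step (n q i : nat) : (0 < n)%nat -> (n <= i < n + q)%nat ->
  ramp n q (S i) = ramp n q i + / INR n * ramp n q i.
Proof.
  intros Hn Hi. rewrite !ramp_above by lia.
  replace (Nat.min (S i - n) q) with (S (Nat.min (i - n) q)) by lia.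
  simpl pow; ring.
Qed.

Lemma ramp_top (n q i : nat) : (0 < n)%nat -> (n + q <= i)%nat ->
  ramp n q i = (1 + / INR n) ^ q.
Proof. intros Hn Hi. rewrite ramp_above by lia. f_equal; lia. Qed.

Lemma ramp_mono (n q i : nat) : (0 < n)%nat -> ramp n q i <= ramp n q (S i).
Proof.
  intro Hn. assert (0 < / INR n) by now apply Rinv_0_lt_compat, lt_0_INR.
  destruct (Nat.lt_ge_cases i n) as [Hi|Hi].
  - rewrite ramp_linear_step by assumption; lra.
  - rewrite !ramp_above by lia. apply Rle_pow; [lra|lia].
Qed.

Lemma ramp_bounds (n q i : nat) : (0 < n)%nat -> 0 <= ramp n q i <= (1 + / INR n) ^ q.
Proof.
  intro Hn. split.
  - induction i as [|i IH]; [rewrite ramp_0; lra|].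
    pose proof (ramp_mono n q i Hn); lra.
  - rewrite <- (ramp_top n q (n + q + i)) by lia.
    replace (n + q + i)%nat with (i + (n + q))%nat by lia.
    generalize (n + q)%nat; intro k; induction k as [|k IH].
    + rewrite Nat.add_0_r; lra.
    + rewrite Nat.add_succ_r. pose proof (ramp_mono n q (i + k) Hn); lra.
Qed.

Lemma ramp_slope (n q i : nat) : (0 < n)%nat ->
  0 <= INR n * (ramp n q (S i) - ramp n q i)
    <= (if Nat.ltb i n then 1 else if Nat.ltb i (n + q) then ramp n q i else 0).
Proof.
  intro Hn. assert (HN : 0 < INR n) by now apply lt_0_INR.
  split.
  - pose proof (ramp_mono n q i Hn). apply Rmult_le_pos; lra.
  - destruct (Nat.ltb_spec i n); [|destruct (Nat.ltb_spec i (n + q))].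
    + rewrite ramp_linear_step by assumption. right; field; lra.
    + rewrite ramp_exp_step by lia. right; field; lra.
    + rewrite !ramp_top by lia. lra.
Qed.

(** The slope is 1 on the linear part, where at most 1 is lost; it equals the
    value on the exponential part, where the two squares cancel; it vanishes on
    the plateau, where the whole square is gained. *)
Lemma ramp_cost (n q i : nat) : (0 < n)%nat ->
  (if Nat.ltb i n then -1 else if Nat.ltb i (n + q) then 0
   else ((1 + / INR n) ^ q) ^ 2)
  <= ramp n q i ^ 2 - (INR n * (ramp n q (S i) - ramp n q i)) ^ 2.
Proof.
  intro Hn.
  pose proof (ramp_slope n q i Hn) as Hs.
  pose proof (ramp_bounds n q i Hn) as Hb.
  destruct (Nat.ltb_spec i n); [|destruct (Nat.ltb_spec i (n + q))].
  - nra.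
  - nra.
  - rewrite <- (ramp_top n q i) by lia. nra.
Qed.

(** On the descending side a step runs from [i + 1] down to [i], so the index to
    compare with on both sides is the lower end of the step. *)
Lemma bump_step (n q j : nat) : (0 < n)%nat -> (j < 3 * n + 2 * q)%nat ->
  let i := Nat.min j (3 * n + 2 * q - S j) in
  ramp n q i <= bump n q j /\
  Rabs (bump n q (S j) - bump n q j) <= ramp n q (S i) - ramp n q i.
Proof.
  intros Hn Hj i. unfold bump.
  set (N := (3 * n + 2 * q)%nat) in *.
  pose proof (ramp_mono n q i Hn) as Hm.
  destruct (Nat.lt_total (S j) (N - j)) as [H|[H|H]].
  - replace (Nat.min j (N - j)) with i by lia.
    replace (Nat.min (S j) (N - S j)) with (S i) by lia.
    rewrite Rabs_pos_eq; lra.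
  - replace (Nat.min j (N - j)) with i by lia.
    replace (Nat.min (S j) (N - S j)) with i by lia.
    rewrite Rminus_diag, Rabs_R0; lra.
  - replace (Nat.min j (N - j)) with (S i) by lia.
    replace (Nat.min (S j) (N - S j)) with i by lia.
    rewrite Rabs_minus_sym, Rabs_pos_eq; lra.
Qed.

Lemma bump_cost (n q j : nat) : (0 < n)%nat -> (j < 3 * n + 2 * q)%nat ->
  ((1 + / INR n) ^ q) ^ 2 * indic (n + q) (2 * n + q) j
    - indic 0 n j - indic (2 * n + 2 * q) (3 * n + 2 * q) j
  <= bump n q j ^ 2 - (INR n * (bump n q (S j) - bump n q j)) ^ 2.
Proof.
  intros Hn Hj.
  assert (HN : 0 < INR n) by now apply lt_0_INR.
  destruct (bump_step n q j Hn Hj) as [H1 H2].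
  set (i := Nat.min j (3 * n + 2 * q - S j)) in *.
  pose proof (ramp_cost n q i Hn) as H3.
  pose proof (ramp_bounds n q i Hn) as H4.
  pose proof (ramp_slope n q i Hn) as H5.
  assert (H6 : (INR n * (bump n q (S j) - bump n q j)) ^ 2
               <= (INR n * (ramp n q (S i) - ramp n q i)) ^ 2).
  { rewrite !Rpow_mult_distr. apply Rmult_le_compat_l; [nra|].
    rewrite <- (pow2_abs (bump n q (S j) - bump n q j)).
    apply pow_incr; split; [apply Rabs_pos|exact H2]. }
  assert (H7 : ramp n q i ^ 2 <= bump n q j ^ 2) by (apply pow_incr; lra).
  eapply Rle_trans; [|apply Rplus_le_compat; [exact H7|apply Ropp_le_contravar, H6]].
  eapply Rle_trans; [|exact H3].
  unfold indic.
  destruct (Nat.leb_spec (n + q) j); destruct (Nat.ltb_spec j (2 * n + q));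
  destruct (Nat.leb_spec 0 j); destruct (Nat.ltb_spec j n);
  destruct (Nat.leb_spec (2 * n + 2 * q) j);
  destruct (Nat.ltb_spec j (3 * n + 2 * q));
  destruct (Nat.ltb_spec i n); destruct (Nat.ltb_spec i (n + q));
  try (exfalso; lia); simpl andb; cbv iota; lra.
Qed.

Lemma bump_bounds (n q j : nat) : (0 < n)%nat ->
  0 <= bump n q j <= (1 + / INR n) ^ q.
Proof. intro Hn. now apply ramp_bounds. Qed.

Lemma bump_lipschitz (n q j : nat) : (0 < n)%nat ->
  Rabs (bump n q (S j) - bump n q j) <= (1 + / INR n) ^ q / INR n.
Proof.
  intro Hn.
  assert (HN : 0 < INR n) by now apply lt_0_INR.
  assert (Hi : 0 < / INR n) by now apply Rinv_0_lt_compat.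
  assert (H1 : 1 <= (1 + / INR n) ^ q) by (apply pow_R1_Rle; lra).
  destruct (Nat.lt_ge_cases j (3 * n + 2 * q)) as [Hj|Hj].
  - destruct (bump_step n q j Hn Hj) as [_ H2].
    eapply Rle_trans; [exact H2|].
    set (i := Nat.min j (3 * n + 2 * q - S j)).
    pose proof (ramp_bounds n q i Hn) as H4.
    destruct (ramp_slope n q i Hn) as [_ H5].
    apply (Rmult_le_reg_l (INR n)); [exact HN|].
    replace (INR n * ((1 + / INR n) ^ q / INR n)) with ((1 + / INR n) ^ q)
      by (field; lra).
    eapply Rle_trans; [exact H5|].
    destruct (Nat.ltb i n); [lra|]. destruct (Nat.ltb i (n + q)); lra.
  - unfold bump. replace (Nat.min j (3 * n + 2 * q - j)) with 0%nat by lia.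
    replace (Nat.min (S j) (3 * n + 2 * q - S j)) with 0%nat by lia.
    rewrite Rminus_diag, Rabs_R0. apply Rmult_le_pos; lra.
Qed.

Lemma exp_pow (x : R) (k : nat) : exp x ^ k = exp (INR k * x).
Proof.
  induction k as [|k IH]; [simpl; now rewrite Rmult_0_l, exp_0|].
  rewrite S_INR, Rmult_plus_distr_r, Rmult_1_l, exp_plus, <- IH. simpl; ring.
Qed.

Lemma exp_le (x y : R) : x <= y -> exp x <= exp y.
Proof. intros [H| ->]; [now apply Rlt_le, exp_increasing|apply Rle_refl]. Qed.

Lemma bump_height_upper (n p : nat) : (0 < n)%nat ->
  (1 + / INR n) ^ (p * n) <= exp (INR p).
Proof.
  intro Hn. assert (HN : 0 < INR n) by now apply lt_0_INR.
  assert (0 < / INR n) by now apply Rinv_0_lt_compat.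
  replace (exp (INR p)) with (exp (/ INR n) ^ (p * n)).
  - apply pow_incr; split; [lra|apply exp_ineq1_le].
  - rewrite exp_pow, mult_INR; f_equal; field; lra.
Qed.

(** From [1 + 1/n >= exp(1/(n+1))] the height is at least [exp(p - p/(n+1))],
    and [p <= n] bounds the loss in the exponent by 1. *)
Lemma bump_height_lower (n p : nat) : (0 < n)%nat -> (p <= n)%nat ->
  exp (INR p - 1) <= (1 + / INR n) ^ (p * n).
Proof.
  intros Hn Hp. assert (HN : 0 < INR n) by now apply lt_0_INR.
  apply le_INR in Hp. pose proof (pos_INR p) as Hp0.
  apply Rle_trans with (exp (/ (INR n + 1)) ^ (p * n)).
  - rewrite exp_pow, mult_INR. apply exp_le.
    apply (Rmult_le_reg_r (INR n + 1)); [lra|].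
    rewrite Rmult_assoc, Rinv_l by lra. nra.
  - apply pow_incr; split; [left; apply exp_pos|].
    pose proof (exp_ineq1_le (- / (INR n + 1))) as E.
    rewrite exp_Ropp in E.
    pose proof (exp_pos (/ (INR n + 1))) as E0.
    set (e := exp (/ (INR n + 1))) in *.
    replace (1 + - / (INR n + 1)) with (/ (1 + / INR n)) in E by (field; lra).
    assert (0 < / INR n) by now apply Rinv_0_lt_compat.
    rewrite <- (Rinv_inv e), <- (Rinv_inv (1 + / INR n)).
    apply Rinv_le_contravar; [apply Rinv_0_lt_compat; lra|exact E].
Qed.

(** * Decay of the semigroup *)

Lemma sum_n_three (a b c : nat -> R) (x y z : R) (n : nat) :
  sum_n (fun j => x * a j - y * b j - z * c j) n
  = x * sum_n a n - y * sum_n b n - z * sum_n c n.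
Proof.
  induction n as [|n IH]; [now rewrite !sum_O|].
  rewrite !sum_Sn, IH. unfold plus; cbn -[INR]. ring.
Qed.

Lemma sum_n_le_loc (a b : nat -> R) (n : nat) :
  (forall j, (j <= n)%nat -> a j <= b j) -> sum_n a n <= sum_n b n.
Proof.
  induction n as [|n IH]; intro H; [rewrite !sum_O; now apply H|].
  rewrite !sum_Sn. apply Rplus_le_compat; [apply IH; intros j Hj|]; apply H; lia.
Qed.

Lemma indic_dec (a b j : nat) :
  (indic a b j = 1 /\ (a <= j < b)%nat) \/ indic a b j = 0.
Proof.
  unfold indic. destruct (Nat.leb_spec a j); destruct (Nat.ltb_spec j b); simpl; auto.
Qed.

(** Balance of the energy inequality for [bump]. With [M >= 1] bounding the
    semigroup, a point [s] of the plateau has [s <= t], hence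
    [|T(t) x| <= M |T(s) x|]; on the linear segments [|T(s) x| <= M |x|]. *)
Lemma decay_on_domain (X : HilbertSpace) (A : LinOp X) (T : R -> X -> X)
    (mu M t : R) (p : nat) (x : X) :
  generates A T -> 0 < mu -> 1 <= M ->
  (forall t y, 0 <= t -> norm (T t y) <= M * norm y) ->
  lower_bound_on_iR X A mu -> dom A x -> INR p + 2 <= mu * t ->
  norm (T t x) <= 2 * exp (1 - INR p) * M ^ 2 * norm x.
Proof.
  intros Hg Hmu HM HT Hco Hx Ht.
  pose proof (pos_INR p) as Hp0.
  set (P := norm (T t x)). set (G := exp (INR p - 1)).
  assert (HP : 0 <= P) by apply norm_ge_0.
  pose proof (norm_ge_0 x) as Hx0.
  assert (HG : 0 < G) by apply exp_pos.
  assert (Key : G ^ 2 * (P / M) ^ 2 <= 2 * (M * norm x) ^ 2).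
  { apply le_epsilon; intros eps Heps.
    (* The sum has [n (3 + 2 p)] terms; this makes its error [mu^2 n eps]. *)
    set (eps' := eps * mu ^ 2 / (3 + 2 * INR p)).
    assert (Heps' : 0 < eps') 
      by (apply Rdiv_lt_0_compat; [apply Rmult_lt_0_compat; [lra|nra]|lra]).
    set (B := exp (INR p) * (1 + mu)).
    assert (Hep : 0 < exp (INR p)) by apply exp_pos.
    assert (HB : 0 <= B) by (unfold B; nra).
    destruct (weighted_trajectory_estimate X A T mu M B eps' x Hg Hmu
      ltac:(lra) HB Heps' HT Hco Hx) as [h0 [Hh0 Hest]].
    destruct (INR_unbounded (/ (mu * h0))) as [k Hk].
    (* Large [n] makes the step small, and [p <= n] keeps the plateau high. *)
    set (n := (k + p + 1)%nat).
    assert (Hn : (0 < n)%nat) by lia. assert (Hpn : (p <= n)%nat) by lia.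
    assert (HN : 0 < INR n) by now apply lt_0_INR.
    assert (Hkn : INR k <= INR n) by (apply le_INR; lia).
    set (q := (p * n)%nat). set (h := / (mu * INR n)).
    pose proof (bump_height_upper n p Hn) as HU.
    pose proof (bump_height_lower n p Hn Hpn) as HL.
    fold q in HU, HL. fold G in HL.
    set (H := (1 + / INR n) ^ q) in *.
    assert (Hh : 0 < h < h0).
    { assert (0 < mu * h0) by nra. assert (0 < mu * INR n) by nra.
      split; [now apply Rinv_0_lt_compat|].
      unfold h. rewrite <- (Rinv_inv h0).
      apply Rinv_lt_contravar.
      - apply Rmult_lt_0_compat; [now apply Rinv_0_lt_compat|assumption].
      - replace (/ h0) with (mu * / (mu * h0)) by (field; lra). nra. }
    assert (HS : S (3 * n + 2 * q - 1) = (3 * n + 2 * q)%nat) by lia.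
    assert (Hb : forall j, 0 <= bump n q j <= H) by (intro; now apply bump_bounds).
    specialize (Hest h (3 * n + 2 * q - 1)%nat (bump n q) Hh).
    rewrite HS in Hest.
    assert (L : mu ^ 2 * INR n * (H ^ 2 * (P / M) ^ 2 - 2 * (M * norm x) ^ 2)
                <= eps' * INR (3 * n + 2 * q)).
    { eapply Rle_trans; [|apply Hest].
      - rewrite (sum_n_ext_loc _ (fun j => mu ^ 2 * (bump n q j ^ 2
          - (INR n * (bump n q (S j) - bump n q j)) ^ 2)
          * norm (T (INR j * h) x) ^ 2)).
        2:{ intros j _. unfold h.
            match goal with |- @eq _ ?a ?b => change (@eq R a b) end.
            field. lra. }
        set (s := H ^ 2 * (P / M) ^ 2). set (m := (M * norm x) ^ 2).
        apply Rle_trans with (sum_n (fun j =>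
          mu ^ 2 * s * indic (n + q) (2 * n + q) j - mu ^ 2 * m * indic 0 n j
          - mu ^ 2 * m * indic (2 * n + 2 * q) (3 * n + 2 * q) j)
          (3 * n + 2 * q - 1)).
        + rewrite sum_n_three, !sum_n_indic by lia.
          replace (2 * n + q - (n + q))%nat with n by lia.
          replace (3 * n + 2 * q - (2 * n + 2 * q))%nat with n by lia.
          rewrite Nat.sub_0_r. right; ring.
        + apply sum_n_le_loc; intros j Hj.
          pose proof (bump_cost n q j Hn ltac:(lia)) as Hc. fold H in Hc.
          set (c := bump n q j ^ 2
            - (INR n * (bump n q (S j) - bump n q j)) ^ 2) in *.
          assert (Hjh : 0 <= INR j * h) by (pose proof (pos_INR j); nra).
          pose proof (HT (INR j * h) x Hjh) as HYu.
          pose proof (norm_ge_0 (T (INR j * h) x)) as HY0.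
          set (y := norm (T (INR j * h) x)) in *.
          assert (HYm : y ^ 2 <= m) by (apply pow_incr; lra).
          assert (HY2 : 0 <= y ^ 2) by nra.
          assert (Hcy : (H ^ 2 * indic (n + q) (2 * n + q) j - indic 0 n j
            - indic (2 * n + 2 * q) (3 * n + 2 * q) j) * y ^ 2 <= c * y ^ 2)
            by now apply Rmult_le_compat_r.
          assert (Hs : indic (n + q) (2 * n + q) j * (P / M) ^ 2
                       <= indic (n + q) (2 * n + q) j * y ^ 2).
          { destruct (indic_dec (n + q) (2 * n + q) j) as [[-> Hi]| ->]; [|lra].
            rewrite !Rmult_1_l. apply pow_incr. split.
            - apply Rmult_le_pos; [exact HP|]. left; apply Rinv_0_lt_compat; lra.
            - apply (Rmult_le_reg_r M); [lra|]. unfold Rdiv.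
              rewrite Rmult_assoc, Rinv_l, Rmult_1_r, Rmult_comm by lra.
              (* The plateau ends at step [2n + q], which is time [(p + 2)/mu]. *)
              assert (Hjt : INR j * h <= t).
              { apply Rle_trans with (INR (2 * n + q) * h).
                - apply Rmult_le_compat_r; [lra|]. apply le_INR; lia.
                - unfold q, h. rewrite plus_INR, !mult_INR. simpl (INR 2).
                  apply (Rmult_le_reg_l mu); [exact Hmu|].
                  replace (mu * (((1 + 1) * INR n + INR p * INR n)
                     * / (mu * INR n))) with (INR p + 2) by (field; lra).
                  exact Ht. }
              unfold P. replace t with ((t - INR j * h) + INR j * h) by ring.
              rewrite (sg_add (proj1 Hg)) by lra. apply HT; lra. }
          assert (Hs1 : indic 0 n j * y ^ 2 <= indic 0 n j * m)
            by (destruct (indic_dec 0 n j) as [[-> _]| ->]; lra).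
          assert (Hs2 : indic (2 * n + 2 * q) (3 * n + 2 * q) j * y ^ 2
                        <= indic (2 * n + 2 * q) (3 * n + 2 * q) j * m)
            by (destruct (indic_dec (2 * n + 2 * q) (3 * n + 2 * q) j)
                  as [[-> _]| ->]; lra).
          assert (HH : 0 <= H ^ 2) by nra.
          apply Rmult_le_compat_l with (r := H ^ 2) in Hs; [|exact HH].
          rewrite (Rmult_assoc _ c), !(Rmult_assoc (mu ^ 2)).
          rewrite <- !Rmult_minus_distr_l.
          apply Rmult_le_compat_l; [nra|]. unfold s. lra.
      - unfold bump; simpl Nat.min; apply ramp_0.
      - unfold bump; rewrite Nat.sub_diag, Nat.min_0_r; apply ramp_0.
      - intro j. rewrite Rabs_pos_eq by apply Hb.
        specialize (Hb j). unfold B. nra.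
      - intro j. eapply Rle_trans; [now apply bump_lipschitz|]. fold H.
        unfold h, B. apply (Rmult_le_reg_r (mu * INR n)); [nra|].
        rewrite (Rmult_assoc (exp _ * _)), Rinv_l, Rmult_1_r by nra.
        replace (H / INR n * (mu * INR n)) with (mu * H) by (field; lra).
        nra. }
    assert (E : eps' * INR (3 * n + 2 * q) = mu ^ 2 * INR n * eps).
    { unfold eps', q. rewrite plus_INR, !mult_INR. simpl (INR 3). simpl (INR 2).
      field. lra. }
    rewrite E in L. apply Rmult_le_reg_l in L; [|apply Rmult_lt_0_compat; nra].
    assert (HGH : G ^ 2 <= H ^ 2) by (apply pow_incr; lra).
    assert (HPM : 0 <= (P / M) ^ 2) by apply pow2_ge_0.
    apply (Rmult_le_compat_r _ _ _ HPM) in HGH. lra. }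
  assert (HGi : exp (1 - INR p) = / G).
  { unfold G. rewrite <- exp_Ropp. f_equal; ring. }
  rewrite HGi.
  assert (Hsq : G * (P / M) <= 2 * (M * norm x)).
  { apply Rsqr_incr_0_var; [unfold Rsqr; nra|nra]. }
  apply (Rmult_le_reg_l (G / M)); [apply Rdiv_lt_0_compat; lra|].
  replace (G / M * P) with (G * (P / M)) by (field; lra).
  replace (G / M * (2 * / G * M ^ 2 * norm x)) with (2 * (M * norm x))
    by (field; lra).
  exact Hsq.
Qed.

Lemma bound_of_dense (X : NormedModule C_AbsRing) (E : X -> Prop) (L : X -> X)
    (c M : R) :
  dense E -> is_linear L -> 0 <= c -> 0 < M ->
  (forall x, norm (L x) <= M * norm x) ->
  (forall x, E x -> norm (L x) <= c * norm x) ->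
  forall x, norm (L x) <= c * norm x.
Proof.
  intros HE HL Hc HM Hb HEc x.
  apply le_epsilon; intros eps Heps.
  pose proof (@norm_factor_gt_0 _ X) as Hf.
  assert (Hd : 0 < eps / ((c + M) * @norm_factor _ X))
    by (apply Rdiv_lt_0_compat; nra).
  destruct (HE x (mkposreal _ Hd)) as [y [Hy Hxy]].
  apply norm_compat2 in Hxy. simpl in Hxy.
  replace (@norm_factor _ X * (eps / ((c + M) * @norm_factor _ X)))
    with (eps / (c + M)) in Hxy by (field; lra).
  pose proof (HEc y Hy) as Hy1.
  pose proof (Hb (minus y x)) as Hyx.
  rewrite linear_minus in Hyx by exact HL.
  pose proof (norm_triangle_inv (L y) (L x)) as H1.
  pose proof (norm_triangle_inv y x) as H2.
  apply Rabs_le_between in H1. apply Rabs_le_between in H2.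
  assert (H3 : (c + M) * norm (minus y x) <= eps).
  { apply Rle_trans with ((c + M) * (eps / (c + M))); [|right; field; lra].
    apply Rmult_le_compat_l; lra. }
  nra.
Qed.

Theorem theorem8p1 :
  exists C0 : R, 0 < C0 /\
  forall (mu M : R) (X : HilbertSpace) (A : LinOp X) (T : R -> X -> X),
    0 < mu ->
    1 <= M ->
    separable X ->
    densely_defined A ->
    closed_op A ->
    generates A T ->
    (forall t : R, 0 <= t -> Rbar_le (op_norm (T t)) (Finite M)) ->
    (forall lambda : R, exists S : X -> X,
        is_resolvent A (Cmult Ci (RtoC lambda)) S /\
        Rbar_le (op_norm S) (Finite (/ mu))) ->
    forall t : R, 0 <= t ->
      Rbar_le (op_norm (T t)) (Finite (C0 * M ^ 2 * exp (- mu * t))).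
Proof.
  (* The exponent 4: two units of [1/mu] for the linear segment and the plateau,
     one for rounding [mu t] down, one for [bump_height_lower]. *)
  exists (2 * exp 4). split; [pose proof (exp_pos 4); lra|].
  intros mu M X A T Hmu HM _ Hdense _ Hg HT Hres t Ht.
  assert (Hb : forall s y, 0 <= s -> norm (T s y) <= M * norm y).
  { intros s y Hs. apply op_norm_bound; [|now apply HT].
    intros a z. exact (linear_scal _ (sg_linear (proj1 Hg) Hs) a z). }
  pose proof (resolvent_lower_bound X A mu Hres) as Hco.
  set (c := 2 * exp 4 * M ^ 2 * exp (- mu * t)).
  enough (Hdom : forall x : X, dom A x -> norm (T t x) <= c * norm x).
  { assert (Hc : 0 <= c).
    { unfold c. pose proof (exp_pos 4). pose proof (exp_pos (- mu * t)).
      repeat apply Rmult_le_pos; nra. }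
    apply op_norm_le; intros x Hx.
    pose proof (bound_of_dense X (dom A) (T t) c M Hdense
      (sg_linear (proj1 Hg) Ht) Hc ltac:(lra) (fun y => Hb t y Ht) Hdom x).
    nra. }
  intros x Hx. pose proof (norm_ge_0 x) as Hx0.
  destruct (Rle_dec 2 (mu * t)) as [H2|H2].
  - destruct (nfloor_ex (mu * t - 2)) as [p [Hp1 Hp2]]; [lra|].
    eapply Rle_trans.
    + apply (decay_on_domain X A T mu M t p x); try assumption; lra.
    + apply Rmult_le_compat_r; [exact Hx0|]. unfold c.
      replace (2 * exp 4 * M ^ 2 * exp (- mu * t))
        with (2 * exp (4 - mu * t) * M ^ 2).
      * apply Rmult_le_compat_r; [nra|].
        apply Rmult_le_compat_l; [lra|]. apply exp_le; lra.
      * replace (4 - mu * t) with (4 + - mu * t) by ring. rewrite exp_plus; ring.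
  - eapply Rle_trans; [now apply Hb|].
    apply Rmult_le_compat_r; [exact Hx0|]. unfold c.
    replace (2 * exp 4 * M ^ 2 * exp (- mu * t))
      with (2 * exp (4 - mu * t) * M ^ 2).
    + assert (1 <= exp (4 - mu * t)) by (rewrite <- exp_0; apply exp_le; lra).
      nra.
    + replace (4 - mu * t) with (4 + - mu * t) by ring. rewrite exp_plus; ring.
Qed.
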